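(* Let $\delta\in(0,1)$. There is a constant $C=C(\delta)>0$ such that the following holds, with no upper bound imposed on the spectral radius (which may grow with $n$). Let $G=(V,E)$ be a graph on $n$ vertices whose adjacency matrix has spectral radius $\rho_G>1$, and let $\mu_G$ be the zero external field Ising model on $G$ with parameter $\beta$ satisfying $$\frac{\rho_G-1+\delta}{\rho_G+1-\delta}\ \le\ \beta\ \le\ \frac{\rho_G+1-\delta}{\rho_G-1+\delta}.$$ Then the mixing time of the Glauber dynamics on $\mu_G$ is at most $C\,n^{1+\frac1\delta}$.
   Context: All graphs are finite, undirected, simple and connected. The adjacency matrix is the $V\times V$ $0/1$ matrix whose $(u,w)$ entry is $1$ iff $u,w$ are adjacent; its spectral radius is the maximum modulus of its eigenvalues. The zero external field Ising model with parameter $\beta>0$ is the distribution on $\{\pm1\}^V$ with $\mu_G(\sigma)\propto \beta^{\#\{\{x,y\}\in E:\ \sigma(x)=\sigma(y)\}}$. Glauber dynamics for a distribution $\mu$ on $\{\pm1\}^V$: the discrete-time Markov chain $(X_t)_{t\ge0}$ on the support of $\mu$ which, given $X_t$, picks a vertex $v$ uniformly at random, sets $X_{t+1}(w)=X_t(w)$ for all $w\ne v$, and samples $X_{t+1}(v)$ from the marginal of $\mu$ at $v$ conditional on the configuration $X_{t+1}$ on the neighbours of $v$. With transition matrix $P$ and stationary distribution $\mu$, the mixing time is $T_{\rm mix}=\min\{t\ge0:\ \|P^t(\sigma,\cdot)-\mu\|_{tv}\le 1/4\ \text{for all }\sigma\}$, where $\|\nu-\hat\nu\|_{tv}=\frac12\sum_x|\nu(x)-\hat\nu(x)|$.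 *)

(* Defs.v *)
From HB Require Import structures.
From mathcomp Require Import all_boot all_order all_algebra.
From mathcomp Require Import classical_sets reals constructive_ereal ereal exp.
From mathcomp.real_closed Require Import complex.

Set Implicit Arguments.
Unset Strict Implicit.
Unset Printing Implicit Defensive.

Import Order.TTheory GRing.Theory Num.Theory.
Local Open Scope ring_scope.

(* An S x S array as a MathComp matrix, S being enumerated by enum_val. *)
Definition mx_of (R : Type) (S : finType) (f : S -> S -> R) : 'M[R]_#|S| :=
  \matrix_(i, j) f (enum_val i) (enum_val j).

(* A graph on V is given by its adjacency relation. *)
Definition simple_connected_graph (V : finType) (e : rel V) : Prop :=
  [/\ symmetric e, irreflexive e & forall u w : V, connect e u w].

Definition adjacency_mx (R : realType) (V : finType) (e : rel V)
    : 'M[R]_#|V| :=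
  mx_of (fun u w => (e u w)%:R).

(* Maximum modulus of the complex eigenvalues. For a nonempty matrix the set
   is finite and nonempty, so that the supremum is a maximum. *)
Definition spectral_radius (R : realType) (n : nat) (A : 'M[R]_n) : R :=
  sup ([set r : R | exists2 z : R[i],
         eigenvalue (map_mx (real_complex R) A) z & `|z| = real_complex R r]%classic).

(* Configurations: the spins +1 and -1 are encoded as true and false. *)
Definition config (V : finType) := {ffun V -> bool}.

Definition mono_edges (V : finType) (e : rel V) (s : config V)
    : {set {set V}} :=
  [set [set x; y] | x in V, y in V & e x y && (s x == s y)].

Definition ising_weight (R : realType) (V : finType) (e : rel V) (beta : R)
    (s : config V) : R :=
  beta ^+ #|mono_edges e s|.

Definition ising (R : realType) (V : finType) (e : rel V) (beta : R)
    (s : config V) : R :=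
  ising_weight e beta s / \sum_(t : config V) ising_weight e beta t.

(* The conditional probability, under mu, that the spin at v is t v given that
   the configuration on the neighbours of v is that of t. *)
Definition cond_marginal (R : realType) (V : finType) (e : rel V)
    (mu : config V -> R) (v : V) (t : config V) : R :=
  let agree (h : config V) := [forall w, e v w ==> (h w == t w)] in
  (\sum_(h : config V | agree h && (h v == t v)) mu h) /
  (\sum_(h : config V | agree h) mu h).

(* Probability of moving from s to t in one step. All configurations are taken
   as states: for beta > 0 the Ising model has full support. *)
Definition glauber (R : realType) (V : finType) (e : rel V)
    (mu : config V -> R) (s t : config V) : R :=
  \sum_(v : V) #|V|%:R^-1 *
    (if [forall w, (w != v) ==> (t w == s w)]
     then cond_marginal e mu v t else 0).

Definition tv_dist (R : realType) (S : finType) (nu nu' : S -> R) : R :=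
  2^-1 * \sum_(x : S) `|nu x - nu' x|.

Definition chain_pow (R : realType) (S : finType) (P : S -> S -> R) (t : nat)
    (x y : S) : R :=
  (mx_of P ^+ t) (enum_rank x) (enum_rank y).

(* The least t >= 0 with the stated property, and +oo if there is none. *)
Definition mixing_time (R : realType) (S : finType) (P : S -> S -> R)
    (mu : S -> R) : \bar R :=
  ereal_inf ([set (t%:R)%:E | t in
    [set t : nat | forall x : S, tv_dist (chain_pow P t x) mu <= 4^-1]]%classic).

(* Main.v *)
Require Import Defs.
From HB Require Import structures.
From mathcomp Require Import all_boot all_order all_algebra.
From mathcomp Require Import classical_sets reals constructive_ereal ereal exp.
From mathcomp.real_closed Require Import complex.
From mathcomp Require Import spectral sesquilinear ring lra.
Import Order.TTheory GRing.Theory Num.Theory.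
Local Open Scope ring_scope.

(** The range of beta says exactly that
    |beta - 1| / (beta + 1) <= kappa := (1 - delta) / rho,
    and |beta - 1| / (beta + 1) bounds the influence of one neighbour: flipping
    the spin at w changes the conditional law of the spin at an adjacent v by at
    most that much ([heat_bath_influence]).  The matrix of influences is thus
    dominated by kappa A, where A is the adjacency matrix, and kappa A has
    spectral radius 1 - delta: this is Dobrushin's uniqueness condition, in
    spectral norm.

    The contraction is followed on test functions instead of couplings.  If the
    function a : V -> R bounds the oscillations of f (flipping the spin at w
    changes f by at most a w), then M a bounds the oscillations of P f, where
    M = (1 - 1/n) I + (kappa / n) A ([glauber_oscillation]).  The difference of
    two values of f is at most the sum of its oscillations, so for |f| <= 1 the
    function P^t f varies by at most twice the sum of the entries of M^t, and by
    reversibility this controls the distance to equilibrium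
    ([tv_dist_le_variation]).  The matrix A being symmetric, the spectral theorem
    bounds the sum of the entries of M^t by n (1 - delta / n)^t
    ([sum_exp_symmetric_le], [eigenvalue_dobrushin_mx]).

    This quantity is at most 1/4 for t of order n log n / delta.  Since
    1 + 1 / delta > 2, a number of steps of order n^2 / delta is affordable, and
    for it the inequality of Bernoulli is enough. *)

(** * Conditional laws of the Ising model *)

Definition set_spin {V : finType} (s : config V) (v : V) (b : bool) : config V :=
  [ffun w => if w == v then b else s w].

(** Number of neighbours of v whose spin is b. *)
Definition spin_degree {V : finType} (e : rel V) (s : config V) (v : V)
    (b : bool) : nat :=
  #|[set w | e v w && (s w == b)]|.

(** Conditional probability, under the Ising model, that the spin at v is b
    given that its neighbours have their spins in s ([cond_marginal_ising]). *)
Definition heat_bath {R : realType} {V : finType} (e : rel V) (beta : R)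
    (s : config V) (v : V) (b : bool) : R :=
  beta ^+ spin_degree e s v b /
  (beta ^+ spin_degree e s v b + beta ^+ spin_degree e s v (~~ b)).

Lemma set_spin_id {V : finType} (s : config V) (v : V) : set_spin s v (s v) = s.
Proof. by apply/ffunP=> w; rewrite ffunE; case: eqP => // ->. Qed.

Lemma set_spin_set {V : finType} (s : config V) (v : V) (b c : bool) :
  set_spin (set_spin s v b) v c = set_spin s v c.
Proof. by apply/ffunP=> w; rewrite !ffunE; case: eqP. Qed.

Lemma set_spinC {V : finType} (s : config V) (v w : V) (b c : bool) :
  v != w -> set_spin (set_spin s v b) w c = set_spin (set_spin s w c) v b.
Proof.
move=> vw; apply/ffunP=> u; rewrite !ffunE.
by case: (eqVneq u w) => // ->; rewrite eq_sym (negPf vw).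
Qed.

Lemma spin_degree_set {V : finType} (e : rel V) (s : config V) (v : V)
    (b c : bool) :
  irreflexive e -> spin_degree e (set_spin s v b) v c = spin_degree e s v c.
Proof.
move=> irr; apply: eq_card => w; rewrite !inE ffunE.
by case: (eqVneq w v) => // ->; rewrite irr.
Qed.

Lemma heat_bath_set {R : realType} {V : finType} (e : rel V) (beta : R)
    (s : config V) (v : V) (b c : bool) :
  irreflexive e -> heat_bath e beta (set_spin s v b) v c = heat_bath e beta s v c.
Proof. by move=> irr; rewrite /heat_bath !spin_degree_set. Qed.

(** Splitting off the monochromatic edges at v isolates the dependence of the
    weight on the spin at v: the second term ignores it
    ([card_mono_edges_away]). *)
Lemma card_mono_edges {V : finType} (e : rel V) (s : config V) (v : V) :
  symmetric e -> irreflexive e ->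
  #|mono_edges e s| =
    (spin_degree e s v (s v) +
     #|[set E in mono_edges e s | v \notin E]|)%N.
Proof.
move=> sym irr.
rewrite -(cardsID [set E : {set V} | v \in E] (mono_edges e s)); congr (_ + _)%N.
  rewrite /spin_degree -(card_in_imset (f := fun w => [set v; w])).
    apply: eq_card => E; rewrite !inE; apply/andP/imsetP.
      case=> /imset2P[x y _]; rewrite !inE => /andP[_ /andP[exy /eqP sxy]] ->.
      rewrite !inE => /orP[] /eqP ->.
        by exists y => //; rewrite inE exy sxy eqxx.
      by exists x; rewrite ?inE 1?sym ?exy ?sxy ?eqxx // finset.setUC.
    case=> w; rewrite inE => /andP[evw /eqP sw] ->; split; last first.
      by rewrite !inE eqxx.
    by apply/imset2P; exists v w; rewrite // !inE evw sw eqxx.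
  move=> w w'; rewrite !inE => /andP[evw _] /andP[evw' _] /setP /(_ w).
  rewrite !inE eqxx orbT => /esym/orP[] /eqP // wv.
  by rewrite wv irr in evw.
by apply: eq_card => E; rewrite !inE andbC.
Qed.

Lemma card_mono_edges_away {V : finType} (e : rel V) (s : config V) (v : V)
    (b c : bool) :
  #|[set E in mono_edges e (set_spin s v b) | v \notin E]| =
  #|[set E in mono_edges e (set_spin s v c) | v \notin E]|.
Proof.
have sub b' c' : [set E in mono_edges e (set_spin s v b') | v \notin E] \subset
                 [set E in mono_edges e (set_spin s v c') | v \notin E].
  apply/fintype.subsetP => E; rewrite !inE => /andP[/imset2P[x y _]].
  rewrite !inE !ffunE => /andP[_ /andP[exy sxy]] -> vxy.
  rewrite vxy andbT; apply/imset2P; exists x y => //.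
  move: vxy sxy; rewrite !inE !ffunE negb_or ![v == _]eq_sym.
  by case/andP=> /negPf -> /negPf -> ->; rewrite exy.
by apply/eqP; rewrite eqn_leq !subset_leq_card.
Qed.

(** The odds of b against c at v are beta to the difference of the spin degrees;
    written as a product so that no division occurs. *)
Lemma ising_weight_set_spin {R : realType} {V : finType} (e : rel V) (beta : R)
    (s : config V) (v : V) (b c : bool) :
  symmetric e -> irreflexive e ->
  ising_weight e beta (set_spin s v b) * beta ^+ spin_degree e s v c =
  ising_weight e beta (set_spin s v c) * beta ^+ spin_degree e s v b.
Proof.
move=> sym irr; rewrite /ising_weight !(card_mono_edges e _ v) //.
rewrite (card_mono_edges_away e s v b c) !spin_degree_set // !ffunE eqxx.
move: (spin_degree e s v b) (spin_degree e s v c) #|_| => i j k.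
by rewrite !exprD; ring.
Qed.

Lemma ising_partition_gt0 {R : realType} {V : finType} (e : rel V) (beta : R) :
  0 < beta -> 0 < \sum_(t : config V) ising_weight e beta t.
Proof.
move=> b0; rewrite (bigD1 [ffun => true]) //= ltr_wpDr ?exprn_gt0 //.
by apply: sumr_ge0 => t _; rewrite exprn_ge0 // ltW.
Qed.

Lemma ising_gt0 {R : realType} {V : finType} (e : rel V) (beta : R)
    (s : config V) : 0 < beta -> 0 < ising e beta s.
Proof.
by move=> b0; rewrite divr_gt0 ?ising_partition_gt0 ?exprn_gt0.
Qed.

Lemma sum_ising {R : realType} {V : finType} (e : rel V) (beta : R) :
  0 < beta -> \sum_s ising e beta s = 1.
Proof.
by move=> b0; rewrite -mulr_suml divff // gt_eqF // ising_partition_gt0.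
Qed.

Lemma ising_set_spin {R : realType} {V : finType} (e : rel V) (beta : R)
    (s : config V) (v : V) (b c : bool) :
  symmetric e -> irreflexive e ->
  ising e beta (set_spin s v b) * beta ^+ spin_degree e s v c =
  ising e beta (set_spin s v c) * beta ^+ spin_degree e s v b.
Proof.
by move=> sym irr; rewrite ![ising _ _ _ * _]mulrAC ising_weight_set_spin.
Qed.

(** Domain Markov property.  Setting the spin at v to b maps the configurations
    that agree with t around v and have spin c at v bijectively onto those with
    spin b, and changes all the weights by the same factor; so the odds of the
    sums are the odds of each configuration. *)
Lemma cond_marginal_ising {R : realType} {V : finType} (e : rel V) (beta : R)
    (v : V) (t : config V) :
  symmetric e -> irreflexive e -> 0 < beta ->
  cond_marginal e (ising e beta) v t = heat_bath e beta t v (t v).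
Proof.
move=> sym irr b0; rewrite /cond_marginal /=.
set agree := fun h : config V => [forall w, e v w ==> (h w == t w)].
pose S b := \sum_(h | agree h && (h v == b)) ising e beta h.
have agree_set h b : agree (set_spin h v b) = agree h.
  apply: eq_forallb => w; rewrite ffunE.
  by case: (eqVneq w v) => // ->; rewrite irr.
have agree_degree h b : agree h -> spin_degree e h v b = spin_degree e t v b.
  move=> /forallP ah; apply: eq_card => w; rewrite !inE.
  by move/implyP: (ah w); case: (e v w) => // /(_ isT) /eqP ->.
have exchange b c : S b * beta ^+ spin_degree e t v c =
                    S c * beta ^+ spin_degree e t v b.
  rewrite /S (reindex_onto (fun h => set_spin h v b) (fun h => set_spin h v c)).
    rewrite !mulr_suml; apply: eq_big => h.
      rewrite agree_set ffunE !eqxx andbT set_spin_set.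
      congr (_ && _); apply/eqP/eqP => [<- | <-]; last exact: set_spin_id.
      by rewrite ffunE eqxx.
    rewrite agree_set set_spin_set => /andP[/andP[ah _] /eqP hc].
    by rewrite -(agree_degree h c) // -(agree_degree h b) // ising_set_spin // hc.
  by move=> h /andP[_ /eqP <-]; rewrite set_spin_set set_spin_id.
have -> : \sum_(h | agree h) ising e beta h = S (t v) + S (~~ t v).
  rewrite (bigID (fun h : config V => h v == t v)) /=; congr (_ + _).
  by apply: eq_bigl => h; case: (h v) (t v) => [] [].
have S0 : 0 < S (t v).
  rewrite /S (bigD1 t) /=; last first.
    by rewrite eqxx andbT; apply/forallP => w; rewrite eqxx implybT.
  rewrite ltr_wpDr ?ising_gt0 //.
  by apply: sumr_ge0 => h _; rewrite ltW ?ising_gt0.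
rewrite -/(S (t v)) /heat_bath.
have := exchange (t v) (~~ t v).
have S0' : 0 <= S (~~ t v) by apply: sumr_ge0 => h _; rewrite ltW ?ising_gt0.
have p0 := exprn_gt0 (spin_degree e t v (t v)) b0.
have p0' := exprn_gt0 (spin_degree e t v (~~ t v)) b0.
move=> E; apply/eqP; rewrite eqr_div; first by apply/eqP; ring: E.
  by rewrite gt_eqF // ltr_wpDr.
by rewrite gt_eqF // addr_gt0.
Qed.

(** * Reversibility and the action on functions *)

Lemma glauber_detailed_balance {R : realType} {V : finType} (e : rel V)
    (beta : R) (s t : config V) :
  symmetric e -> irreflexive e -> 0 < beta ->
  ising e beta s * glauber e (ising e beta) s t =
  ising e beta t * glauber e (ising e beta) t s.
Proof.
move=> sym irr b0; rewrite /glauber !mulr_sumr; apply: eq_bigr => v _.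
rewrite !(mulrCA (ising e beta _)); congr (_ * _).
have -> : [forall w, (w != v) ==> (s w == t w)] =
          [forall w, (w != v) ==> (t w == s w)].
  by apply: eq_forallb => w; rewrite [s w == _]eq_sym.
case: ifP => [/forallP st|_]; last by rewrite !mulr0.
have {st} -> : t = set_spin s v (t v).
  apply/ffunP => w; rewrite ffunE; case: (eqVneq w v) => [-> //|wv].
  by apply/eqP/(implyP (st w)).
rewrite !cond_marginal_ising // heat_bath_set // ffunE eqxx.
rewrite -{1}(set_spin_id s v) /heat_bath !mulrA.
have := ising_set_spin e beta s v (s v) (t v) sym irr.
by move=> ->; congr (_ / _); case: (s v) (t v) => [] []; rewrite // addrC.
Qed.

(** A Glauber step from s through v can only reach the two configurations
    obtained from s by setting the spin at v. *)
Lemma glauberE {R : realType} {V : finType} (e : rel V) (beta : R)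
    (f : config V -> R) (s : config V) :
  symmetric e -> irreflexive e -> 0 < beta ->
  \sum_t glauber e (ising e beta) s t * f t =
  \sum_v #|V|%:R^-1 * (heat_bath e beta s v true * f (set_spin s v true) +
                       heat_bath e beta s v false * f (set_spin s v false)).
Proof.
move=> sym irr b0; rewrite /glauber; under eq_bigr do rewrite mulr_suml.
rewrite exchange_big /=; apply: eq_bigr => v _.
under eq_bigr do rewrite -mulrA; rewrite -mulr_sumr; congr (_ * _).
have neq : set_spin s v false != set_spin s v true.
  by apply/eqP => /ffunP /(_ v); rewrite !ffunE eqxx.
rewrite (bigD1 (set_spin s v true)) //= (bigD1 (set_spin s v false)) //=.
rewrite big1 ?addr0 => [|t /andP[t1 t2]]; last first.
  case: ifP => [/forallP st|_]; last by rewrite mul0r.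
  have tE : t = set_spin s v (t v).
    apply/ffunP => w; rewrite ffunE; case: (eqVneq w v) => [-> //|wv].
    by apply/eqP/(implyP (st w)).
  by case: (t v) tE t1 t2 => ->; rewrite eqxx.
have on b : [forall w, (w != v) ==> (set_spin s v b w == s w)].
  by apply/forallP => w; rewrite ffunE; case: (eqVneq w v) => //= _; rewrite eqxx.
by rewrite !on !cond_marginal_ising // !heat_bath_set // !ffunE eqxx.
Qed.

(** * Contraction of oscillations *)

Definition oscillation_le {R : realType} {V : finType} (f : config V -> R)
    (a : V -> R) : Prop :=
  forall (s : config V) (w : V) (b : bool), `|f (set_spin s w b) - f s| <= a w.

(** The sharp bound on the influence of a neighbour.  The difference equals
    (beta^2 - 1) x y / ((beta x + y) (x + beta y)), and the denominator is at
    least (beta + 1)^2 x y because it exceeds it by beta (x - y)^2. *)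
Lemma two_point_ratio_le {R : realType} (beta kappa x y : R) :
  0 < beta -> `|beta - 1| <= kappa * (beta + 1) -> 0 < x -> 0 < y ->
  `|beta * x / (beta * x + y) - x / (x + beta * y)| <= kappa.
Proof.
move=> b0 hk x0 y0.
have d1 : 0 < beta * x + y by rewrite addr_gt0 ?mulr_gt0.
have d2 : 0 < x + beta * y by rewrite addr_gt0 ?mulr_gt0.
have -> : beta * x / (beta * x + y) - x / (x + beta * y) =
    (beta - 1) * ((beta + 1) * (x * y)) / ((beta * x + y) * (x + beta * y)).
  by field; rewrite !gt_eqF.
have b1 : 0 < beta + 1 by rewrite addr_gt0.
have xy0 : 0 < (beta + 1) * (x * y) by rewrite !mulr_gt0.
rewrite normrM normfV (gtr0_norm (mulr_gt0 d1 d2)) ler_pdivrMr ?mulr_gt0 //.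
rewrite normrM (gtr0_norm xy0).
have k0 : 0 <= kappa by rewrite -(pmulr_lge0 _ b1) (le_trans _ hk).
apply: (@le_trans _ _ (kappa * (beta + 1) * ((beta + 1) * (x * y)))).
  by rewrite ler_wpM2r // ltW.
rewrite -mulrA ler_wpM2l //.
have : 0 <= beta * (x - y) ^+ 2 by rewrite mulr_ge0 ?sqr_ge0 ?ltW.
by nra.
Qed.

Lemma spin_degree_set_neighbour {V : finType} (e : rel V) (s : config V)
    (v w : V) (b c : bool) :
  e v w ->
  spin_degree e (set_spin s w b) v c =
  ((b == c) + #|[set u in [set u | e v u && (s u == c)] | u != w]|)%N.
Proof.
move=> evw; rewrite /spin_degree (cardsD1 w) !inE ffunE eqxx evw /=.
congr (_ + _)%N; apply: eq_card => u; rewrite !inE ffunE andbC.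
by case: (eqVneq u w) => //=; rewrite !andbF.
Qed.

(** With i and j the numbers of neighbours of v other than w that have the spin c,
    respectively the opposite one, moving w from one class to the other moves
    the probability of c between the two ratios of [two_point_ratio_le] for
    x = beta^i and y = beta^j, or for the reverse. *)
Lemma heat_bath_influence {R : realType} {V : finType} (e : rel V)
    (beta kappa : R) (s : config V) (v w : V) (b c : bool) :
  0 < beta -> `|beta - 1| <= kappa * (beta + 1) ->
  `|heat_bath e beta (set_spin s w b) v c - heat_bath e beta s v c|
    <= kappa * (e v w)%:R.
Proof.
move=> b0 hk.
have k0 : 0 <= kappa.
  have b1 : 0 < beta + 1 by rewrite addr_gt0.
  by rewrite -(pmulr_lge0 _ b1) (le_trans _ hk).
case: (eqVneq b (s w)) => [->|bs].
  by rewrite set_spin_id subrr normr0 mulr_ge0.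
case evw: (e v w); last first.
  suff same d : spin_degree e (set_spin s w b) v d = spin_degree e s v d.
    by rewrite /heat_bath !same subrr normr0 mulr0.
  apply: eq_card => u; rewrite !inE ffunE.
  by case: (eqVneq u w) => // ->; rewrite evw.
rewrite mulr1 -{2}(set_spin_id s w) /heat_bath.
rewrite !spin_degree_set_neighbour //.
move: #|_| #|_| => i j.
have x0 := exprn_gt0 i b0; have y0 := exprn_gt0 j b0.
have up := two_point_ratio_le _ _ _ _ b0 hk x0 y0.
have down := two_point_ratio_le _ _ _ _ b0 hk y0 x0.
have up' := up; have down' := down; rewrite distrC in up'; rewrite distrC in down'.
by case: b c (s w) bs => [] [] [] //= _; rewrite ?add0n ?add1n ?exprS.
Qed.

(** The new oscillation bound at w: the step selects w with probability 1 / n,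
    which erases the dependence on the spin at w; selecting a neighbour v of w
    passes a share kappa of the oscillation at v on to w. *)
Definition dobrushin_step {R : realType} {V : finType} (e : rel V) (kappa : R)
    (a : V -> R) (w : V) : R :=
  (1 - #|V|%:R^-1) * a w + kappa / #|V|%:R * \sum_v (e w v)%:R * a v.

(** When v <> w is updated, with p and q the laws of the new spin at v with and
    without the spin at w set to b, and A, B, C, D the values of f after the
    update (A and C with the spin at w set, A and B with spin true at v), the
    difference splits as
    q (A - B) + (1 - q) (C - D) + (p - q) (A - C).
    The first two terms compare configurations that differ at w; the last one is
    the influence of w on v times an oscillation at v. *)
Lemma glauber_oscillation {R : realType} {V : finType} (e : rel V)
    (beta kappa : R) (f : config V -> R) (a : V -> R) :
  symmetric e -> irreflexive e -> 0 < beta ->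
  `|beta - 1| <= kappa * (beta + 1) ->
  oscillation_le f a ->
  oscillation_le (fun s => \sum_t glauber e (ising e beta) s t * f t)
    (dobrushin_step e kappa a).
Proof.
move=> sym irr b0 hk fa s w b; rewrite !glauberE // -sumrB.
have n0 : (0 : R) < #|V|%:R by rewrite ltr0n; apply/card_gt0P; exists w.
have -> : dobrushin_step e kappa a w =
    \sum_(v | v != w) #|V|%:R^-1 * (a w + kappa * (e v w)%:R * a v).
  rewrite -mulr_sumr big_split /= sumr_const.
  have -> : #|[pred v | v != w]| = #|V|.-1 by rewrite cardC1.
  have -> : \sum_(v | v != w) kappa * (e v w)%:R * a v =
            kappa * \sum_v (e w v)%:R * a v.
    rewrite mulr_sumr [RHS](bigD1 w) //= irr mul0r mulr0 add0r.
    by apply: eq_bigr => v _; rewrite sym mulrA.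
  rewrite /dobrushin_step -[a w *+ _]mulr_natr -subn1 natrB; last first.
    by rewrite -(ltr0n R).
  by field; rewrite gt_eqF.
rewrite (bigD1 w) //= !set_spin_set !heat_bath_set // subrr add0r.
apply: le_trans (ler_norm_sum _ _ _) _; apply: ler_sum => v vw.
rewrite -mulrBr normrM normfV (gtr0_norm n0).
rewrite ler_wpM2l ?invr_ge0 ?(ltW n0) //.
rewrite ![set_spin (set_spin s w b) v _]set_spinC 1?eq_sym //.
set p := heat_bath _ _ (set_spin s w b) v; set q := heat_bath _ _ s v.
have sum1 h : heat_bath e beta h v false = 1 - heat_bath e beta h v true.
  have x0 := exprn_gt0 (spin_degree e h v true) b0.
  have y0 := exprn_gt0 (spin_degree e h v false) b0.
  by rewrite /heat_bath /=; field; rewrite !gt_eqF ?addr_gt0.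
have pq : `|p true - q true| <= kappa * (e v w)%:R by exact: heat_bath_influence.
have q0 : 0 <= q true <= 1.
  have x0 := exprn_gt0 (spin_degree e s v true) b0.
  have y0 := exprn_gt0 (spin_degree e s v false) b0.
  apply/andP; split; first by rewrite divr_ge0 ?addr_ge0 ?(ltW x0) ?(ltW y0).
  by rewrite /q /heat_bath ler_pdivrMr ?addr_gt0 // mul1r lerDl ltW.
have /andP[q1 q2] := q0.
rewrite /p /q !sum1 -/p -/q.
have fT := fa (set_spin s v true) w b.
have fF := fa (set_spin s v false) w b.
set A := f _ in fT *; set B := f _ in fT *; set C := f _ in fF *; set D := f _ in fF *.
have E : f (set_spin (set_spin s w b) v true) = A by rewrite set_spinC 1?eq_sym.
have fv : `|A - C| <= a v.
  have := fa (set_spin (set_spin s w b) v false) v true.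
  by rewrite set_spin_set E set_spinC 1?eq_sym.
have -> : p true * A + (1 - p true) * C - (q true * B + (1 - q true) * D) =
  q true * (A - B) + (1 - q true) * (C - D) + (p true - q true) * (A - C) by ring.
apply: le_trans (ler_normD _ _) _; apply: lerD.
  apply: le_trans (ler_normD _ _) _.
  have -> : a w = q true * a w + (1 - q true) * a w by ring.
  apply: lerD; rewrite normrM ger0_norm ?subr_ge0 //; apply: ler_wpM2l => //.
  by rewrite subr_ge0.
by rewrite normrM; apply: ler_pM.
Qed.

(** * Powers of symmetric matrices *)

Section SpectralBound.

Local Open Scope sesquilinear_scope.

(** The set of moduli is bounded, here by the sum of the moduli of the roots of
    the characteristic polynomial, so that its supremum is an upper bound. *)
Lemma eigenvalue_le_spectral_radius {R : realType} {n : nat} (A : 'M[R]_n)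
    (z : R[i]) :
  eigenvalue (map_mx (real_complex R) A) z ->
  `|z| <= real_complex R (spectral_radius A).
Proof.
have normE (y : R[i]) : `|y| = real_complex R (complex.Re `|y|).
  by rewrite normc_def.
move=> ez; rewrite normE lecR; apply: ub_le_sup; last by exists z.
have [rs ers] := closed_field_poly_normal (char_poly (map_mx (real_complex R) A)).
have monic := monicP (char_poly_monic (map_mx (real_complex R) A)).
exists (complex.Re (\sum_(y <- rs) `|y|)) => x [y ey yx].
rewrite -lecR -yx.
have -> : real_complex R (complex.Re (\sum_(y <- rs) `|y|)) = \sum_(y <- rs) `|y|.
  by rewrite raddf_sum rmorph_sum; apply: eq_bigr => u _; apply: esym (normE u).
have : y \in rs.
  by move: ey; rewrite eigenvalue_root_char ers monic scale1r root_prod_XsubC.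
elim: rs {ers} => // u rs IH; rewrite inE big_cons => /orP[/eqP ->|/IH le].
  by rewrite lerDl sumr_ge0.
by rewrite ler_wpDl.
Qed.

(** The sum of the entries is the quadratic form of B^t at the all-ones vector.
    In an orthonormal basis of eigenvectors, in which that vector has coordinates
    y, it is the sum of the |y_i|^2 d_i^t, while the sum of the |y_i|^2 is n. *)
Lemma sum_exp_symmetric_le {R : realType} {n : nat} (B : 'M[R]_n) (r : R)
    (t : nat) :
  B^T = B ->
  (forall z, eigenvalue (map_mx (real_complex R) B) z ->
     `|z| <= real_complex R r) ->
  `|\sum_i \sum_j (B ^+ t) i j| <= n%:R * r ^+ t.
Proof.
move=> symB eigB; set Bc := map_mx (real_complex R) B.
have hermB : Bc ^t* = Bc.
  apply/matrixP => i j; rewrite !mxE.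
  have /matrixP /(_ i j) := symB; rewrite mxE => ->.
  by apply: CrealP; apply/complex_realP; exists (B i j).
have normB : Bc \is normalmx by apply/normalmxP; rewrite hermB.
have := orthomx_spectralP normB; rewrite invmx_unitary ?spectral_unitarymx //.
set P := spectralmx Bc; set d := spectral_diag Bc => decB.
have PP : P *m P ^t* = 1%:M by apply/unitarymxP; apply: spectral_unitarymx.
have PP' : P ^t* *m P = 1%:M by apply: mulmx1C.
have PB : P *m Bc = diag_mx d *m P by rewrite {1}decB !mulmxA PP mul1mx.
have d_le i : `|d 0 i| <= real_complex R r.
  apply: eigB; apply/eigenvalueP; exists (row i P).
    rewrite -row_mul PB; apply/rowP => j.
    by rewrite mul_diag_mx !mxE.
  apply/eqP => Pi0; have /matrixP /(_ i i) := PP.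
  rewrite !mxE eqxx big1 => [/eqP|j _]; first by rewrite eq_sym oner_eq0.
  by have /rowP /(_ j) := Pi0; rewrite !mxE => ->; rewrite mul0r.
have PBt : P *m Bc ^+ t = diag_mx (\row_i d 0 i ^+ t) *m P.
  elim: t => [|t IH].
    rewrite expr0 mulmx1 -[LHS]mul1mx; congr (_ *m _).
    by apply/matrixP => i j; rewrite !mxE expr0.
  rewrite exprSr mulmxA IH -mulmxA PB mulmxA mulmx_diag; congr (diag_mx _ *m _).
  by apply/rowP => i; rewrite !mxE exprSr.
pose y := P *m (const_mx 1 : 'cV[R[i]]_n).
have y_norm : \sum_i `|y i 0| ^+ 2 = n%:R.
  have /matrixP /(_ 0 0) : y ^t* *m y = n%:R%:M.
    rewrite /y trmx_mul map_mxM mulmxA -[_ *m _ *m P]mulmxA PP' mulmx1.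
    apply/matrixP => i j; rewrite !mxE !ord1 eqxx mulr1n.
    rewrite (eq_bigr (fun=> 1)) => [|k _]; last by rewrite !mxE rmorph1 mul1r.
    by rewrite sumr_const card_ord.
  rewrite !mxE eqxx mulr1n => <-; apply: eq_bigr => i _.
  by rewrite !mxE normCKC.
have powB : Bc ^+ t = map_mx (real_complex R) (B ^+ t).
  by elim: (t) => [|k IH]; rewrite ?expr0 ?map_mx1 // !exprS map_mxM IH.
have quad : real_complex R (\sum_i \sum_j (B ^+ t) i j) =
            \sum_i `|y i 0| ^+ 2 * d 0 i ^+ t.
  have -> : real_complex R (\sum_i \sum_j (B ^+ t) i j) =
      ((const_mx 1 : 'rV[R[i]]_n) *m Bc ^+ t *m (const_mx 1 : 'cV[R[i]]_n)) 0 0.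
    rewrite mxE exchange_big rmorph_sum /=; apply: eq_bigr => j _.
    rewrite !mxE mulr1 rmorph_sum; apply: eq_bigr => i _.
    by rewrite mxE mul1r powB mxE.
  have -> : Bc ^+ t = P ^t* *m (diag_mx (\row_i d 0 i ^+ t) *m P).
    by rewrite -PBt mulmxA PP' mul1mx.
  have -> : (const_mx 1 : 'rV[R[i]]_n) = (const_mx 1 : 'cV[R[i]]_n) ^t*.
    by apply/matrixP => i j; rewrite !mxE rmorph1.
  rewrite -!mulmxA -/y mulmxA -map_mxM -trmx_mul -/y mxE.
  apply: eq_bigr => i _.
  by rewrite mul_diag_mx !mxE normCKC; ring.
rewrite -lecR.
have -> : real_complex R `|\sum_i \sum_j (B ^+ t) i j| =
          `|real_complex R (\sum_i \sum_j (B ^+ t) i j)|.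
  by rewrite normc_def /= expr0n addr0 sqrtr_sqr.
rewrite quad rmorphM rmorph_nat rmorphXn -y_norm mulr_suml.
apply: le_trans (ler_norm_sum _ _ _) _; apply: ler_sum => i _.
rewrite normrM normrX normr_id ler_wpM2l ?exprn_ge0 //.
rewrite normrX lerXn2r ?nnegrE //.
by apply: le_trans (d_le i).
Qed.

End SpectralBound.

(** * From oscillations to total variation *)

Definition expectation_step {R : realType} {S : finType} (P : S -> S -> R)
    (f : S -> R) (x : S) : R := \sum_y P x y * f y.

Lemma sum_enum_val {R : realType} {S : finType} (F : S -> R) :
  \sum_x F x = \sum_(i < #|S|) F (enum_val i).
Proof. exact: reindex (onW_bij _ (@enum_val_bij S)). Qed.

Lemma chain_pow_expectation {R : realType} {S : finType} (P : S -> S -> R)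
    (t : nat) (f : S -> R) (x : S) :
  \sum_y chain_pow P t x y * f y = iter t (expectation_step P) f x.
Proof.
rewrite -[x in RHS]enum_rankK /chain_pow; move: (enum_rank x) => i {x}.
rewrite sum_enum_val; under eq_bigr do rewrite enum_valK.
elim: t i => [|t IH] i.
  rewrite /= (bigD1 i) //= big1 => [|j ji].
    by rewrite expr0 !mxE eqxx mul1r addr0.
  by rewrite expr0 !mxE eq_sym (negPf ji) mul0r.
rewrite iterS /expectation_step [RHS]sum_enum_val.
under [RHS]eq_bigr do rewrite -IH mulr_sumr.
rewrite exchange_big /=; apply: eq_bigr => j _.
rewrite exprS mxE mulr_suml; apply: eq_bigr => k _.
by rewrite mxE mulrA.
Qed.

Lemma stationary_expectation {R : realType} {S : finType} (P : S -> S -> R)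
    (mu f : S -> R) (t : nat) :
  (forall x y, mu x * P x y = mu y * P y x) -> (forall x, \sum_y P x y = 1) ->
  \sum_x mu x * iter t (expectation_step P) f x = \sum_x mu x * f x.
Proof.
move=> balance stoch; elim: t => //= t <-.
rewrite /expectation_step; under eq_bigr do rewrite mulr_sumr.
rewrite exchange_big /=; apply: eq_bigr => y _.
under eq_bigr do rewrite mulrA balance -mulrA mulrCA mulrC.
by rewrite -mulr_sumr stoch mulr1.
Qed.

(** The distance is realised by the test function f equal to the sign of
    P^t(x, .) - mu: twice the distance is then P^t f(x) - mu(f), and
    mu(f) = mu(P^t f) by stationarity, an average of the values of P^t f. *)
Lemma tv_dist_le_variation {R : realType} {S : finType} (P : S -> S -> R)
    (mu : S -> R) (t : nat) (x : S) (D : R) :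
  (forall x y, mu x * P x y = mu y * P y x) -> (forall x, \sum_y P x y = 1) ->
  (forall x, 0 <= mu x) -> \sum_x mu x = 1 ->
  (forall f, (forall y, `|f y| <= 1) -> forall z,
    `|iter t (expectation_step P) f x - iter t (expectation_step P) f z| <= D) ->
  tv_dist (chain_pow P t x) mu <= D / 2.
Proof.
move=> balance stoch mu0 mu1 var; rewrite /tv_dist mulrC ler_wpM2r ?invr_ge0 //.
pose f y := Num.sg (chain_pow P t x y - mu y).
have f1 y : `|f y| <= 1 by rewrite /f normr_sg; case: (_ != 0).
have -> : \sum_y `|chain_pow P t x y - mu y| =
    \sum_z mu z * (iter t (expectation_step P) f x -
                   iter t (expectation_step P) f z).
  under [RHS]eq_bigr do rewrite mulrBr.
  rewrite sumrB -mulr_suml mu1 mul1r stationary_expectation //.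
  rewrite -chain_pow_expectation -sumrB; apply: eq_bigr => y _.
  by rewrite -mulrBl [LHS]normrEsg mulrC.
apply: le_trans (ler_norm _) _; apply: le_trans (ler_norm_sum _ _ _) _.
rewrite -[D]mul1r -mu1 mulr_suml; apply: ler_sum => z _.
by rewrite normrM ger0_norm // ler_wpM2l // var.
Qed.

(** Go from s to t by setting the spins to those of t one vertex at a time. *)
Lemma oscillation_le_dist {R : realType} {V : finType} (f : config V -> R)
    (a : V -> R) (s t : config V) :
  oscillation_le f a -> `|f t - f s| <= \sum_w a w.
Proof.
move=> fa; pose h r := foldr (fun w h => set_spin h w (t w)) s r.
have hE r u : h r u = if u \in r then t u else s u.
  elim: r => //= w r IH; rewrite ffunE inE.
  by case: (eqVneq u w) => //= ->.
have -> : t = h (enum V) by apply/ffunP => u; rewrite hE mem_enum.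
rewrite -big_enum /=; elim: (enum V) => [|w r IH] /=.
  by rewrite subrr normr0 big_nil.
rewrite big_cons -[f _](subrK (f (h r))) -addrA.
by apply: le_trans (ler_normD _ _) _; apply: lerD (fa _ _ _) IH.
Qed.

Lemma iter_glauber_oscillation {R : realType} {V : finType} (e : rel V)
    (beta kappa : R) (f : config V -> R) (a : V -> R) (t : nat) :
  symmetric e -> irreflexive e -> 0 < beta ->
  `|beta - 1| <= kappa * (beta + 1) -> oscillation_le f a ->
  oscillation_le (iter t (expectation_step (glauber e (ising e beta))) f)
    (iter t (dobrushin_step e kappa) a).
Proof.
by move=> sym irr b0 hk fa; elim: t => //= t IH; apply: glauber_oscillation.
Qed.

(** Matrix of [dobrushin_step]. *)
Definition dobrushin_mx {R : realType} {V : finType} (e : rel V) (kappa : R) :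
    'M[R]_#|V| :=
  (1 - #|V|%:R^-1)%:M + (kappa / #|V|%:R) *: adjacency_mx R e.

Lemma iter_dobrushin_step {R : realType} {V : finType} (e : rel V) (kappa : R)
    (a : V -> R) (t : nat) (i : 'I_#|V|) :
  iter t (dobrushin_step e kappa) a (enum_val i) =
  \sum_j (dobrushin_mx e kappa ^+ t) i j * a (enum_val j).
Proof.
elim: t i => [|t IH] i.
  rewrite /= (bigD1 i) //= big1 => [|j ji].
    by rewrite expr0 !mxE eqxx mul1r addr0.
  by rewrite expr0 !mxE eq_sym (negPf ji) mul0r.
have step b : dobrushin_step e kappa b (enum_val i) =
              \sum_j dobrushin_mx e kappa i j * b (enum_val j).
  under eq_bigr do rewrite !mxE mulrDl -mulrA.
  rewrite big_split /= -mulr_sumr /dobrushin_step sum_enum_val; congr (_ + _).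
  rewrite (bigD1 i) //= big1 ?addr0 ?eqxx ?mulr1n // => j ji.
  by rewrite eq_sym (negPf ji) mulr0n mul0r.
rewrite iterS step; under eq_bigr do rewrite IH mulr_sumr.
rewrite exchange_big /=; apply: eq_bigr => j _.
rewrite exprS mxE mulr_suml; apply: eq_bigr => k _.
by rewrite mulrA.
Qed.

Lemma eigenvalue_dobrushin_mx {R : realType} {V : finType} (e : rel V)
    (kappa : R) (z : R[i]) :
  (0 < #|V|)%N -> 0 < kappa ->
  eigenvalue (map_mx (real_complex R) (dobrushin_mx e kappa)) z ->
  `|z| <= real_complex R
    (1 - (1 - kappa * spectral_radius (adjacency_mx R e)) / #|V|%:R).
Proof.
move=> V0 k0 /eigenvalueP[v ev v0].
have n0 : (0 : R) < #|V|%:R by rewrite ltr0n.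
pose c : R := 1 - #|V|%:R^-1; pose k : R := kappa / #|V|%:R.
have c0 : 0 <= c by rewrite subr_ge0 invf_le1 // ler1n.
have kp : 0 < k by rewrite divr_gt0.
have kC : real_complex R k != 0 by rewrite (fmorph_eq0 (real_complex R)) gt_eqF.
have posC (x : R) : 0 <= x -> `|real_complex R x| = real_complex R x.
  by move=> x0; apply: ger0_norm; rewrite lecR.
pose y := (z - real_complex R c) / real_complex R k.
have ey : eigenvalue (map_mx (real_complex R) (adjacency_mx R e)) y.
  apply/eigenvalueP; exists v => //.
  apply: (scalerI kC); rewrite scalerA /y mulrC mulfVK // scalerBl -ev.
  rewrite /dobrushin_mx map_mxD map_mxZ map_scalar_mx mulmxDr mul_mx_scalar.
  by rewrite addrAC subrr add0r -scalemxAr.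
have -> : z = real_complex R c + real_complex R k * y.
  by rewrite /y mulrC mulfVK // addrC subrK.
apply: le_trans (ler_normD _ _) _; rewrite normrM !posC ?(ltW kp) //.
have -> : 1 - (1 - kappa * spectral_radius (adjacency_mx R e)) / #|V|%:R =
          c + k * spectral_radius (adjacency_mx R e).
  by rewrite /c /k; ring.
rewrite (rmorphD _ c) (rmorphM _ k) lerD2l ler_wpM2l ?eigenvalue_le_spectral_radius //.
by rewrite lecR ltW.
Qed.

(** * Mixing *)

Lemma glauber_row_sum {R : realType} {V : finType} (e : rel V) (beta : R)
    (s : config V) :
  symmetric e -> irreflexive e -> 0 < beta -> (0 < #|V|)%N ->
  \sum_t glauber e (ising e beta) s t = 1.
Proof.
move=> sym irr b0 V0; have n0 : (0 : R) < #|V|%:R by rewrite ltr0n.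
have := glauberE e beta (fun=> 1) s sym irr b0.
under eq_bigr do rewrite mulr1; move=> ->.
rewrite (eq_bigr (fun=> #|V|%:R^-1)) => [|v _].
  by rewrite sumr_const -[_ *+ _]mulr_natr mulVf // gt_eqF.
have x0 := exprn_gt0 (spin_degree e s v true) b0.
have y0 := exprn_gt0 (spin_degree e s v false) b0.
by rewrite /heat_bath /=; field; rewrite !gt_eqF ?addr_gt0.
Qed.

Lemma glauber_tv_le {R : realType} {V : finType} (e : rel V) (beta kappa : R)
    (t : nat) (s : config V) :
  symmetric e -> irreflexive e -> 0 < beta -> (0 < #|V|)%N -> 0 < kappa ->
  `|beta - 1| <= kappa * (beta + 1) ->
  tv_dist (chain_pow (glauber e (ising e beta)) t s) (ising e beta) <=
  #|V|%:R *
    (1 - (1 - kappa * spectral_radius (adjacency_mx R e)) / #|V|%:R) ^+ t.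
Proof.
move=> sym irr b0 V0 k0 hk; set r := 1 - _ / _.
have -> : #|V|%:R * r ^+ t = #|V|%:R * r ^+ t * 2 / 2 by rewrite mulfK.
apply: tv_dist_le_variation.
- by move=> x y; apply: glauber_detailed_balance.
- by move=> x; apply: glauber_row_sum.
- by move=> x; rewrite ltW // ising_gt0.
- exact: sum_ising.
move=> f f1 z; have osc0 : oscillation_le f (fun=> 2).
  (* A function with values in [-1, 1] has all its oscillations bounded by 2. *)
  move=> h w b; apply: le_trans (ler_normB _ _) _.
  by rewrite -[2]/(1 + 1); apply: lerD.
have osc := iter_glauber_oscillation e beta kappa f _ t sym irr b0 hk osc0.
apply: le_trans (oscillation_le_dist _ _ z s osc) _.
rewrite sum_enum_val; under eq_bigr do rewrite iter_dobrushin_step -mulr_suml.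
rewrite -mulr_suml ler_wpM2r //; apply: le_trans (ler_norm _) _.
apply: sum_exp_symmetric_le => [|y]; last exact: eigenvalue_dobrushin_mx.
apply/matrixP => i j; rewrite !mxE sym eq_sym.
by congr (_ + _); case: eqVneq => // ->.
Qed.

(** A division-free form of (1 - x)^t <= 1 / (1 + t x). *)
Lemma exp_subr1_bernoulli {R : realType} (x : R) (t : nat) :
  0 <= x <= 1 -> (1 - x) ^+ t * (1 + t%:R * x) <= 1.
Proof.
move=> /andP[x0 x1]; elim: t => [|t IH]; first by rewrite expr0 mul0r addr0 mulr1.
apply: le_trans IH; rewrite exprSr -mulrA ler_wpM2l ?exprn_ge0 ?subr_ge0 //.
have : 0 <= t.+1%:R * x ^+ 2 :> R by rewrite mulr_ge0 ?sqr_ge0.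
by rewrite -natr1; nra.
Qed.

Theorem theoremC1 (R : realType) (delta : R) :
  0 < delta -> delta < 1 ->
  exists C : R, 0 < C /\
    forall (V : finType) (e : rel V) (beta : R),
      let rho := spectral_radius (adjacency_mx R e) in
      simple_connected_graph e ->
      1 < rho ->
      0 < beta ->
      (rho - 1 + delta) / (rho + 1 - delta) <= beta ->
      beta <= (rho + 1 - delta) / (rho - 1 + delta) ->
      (mixing_time (glauber e (ising e beta)) (ising e beta)
         <= (C * (#|V|%:R `^ (1 + 1 / delta)))%:E)%E.
Proof.
move=> d0 d1; exists (4 / delta + 1); split; first by rewrite addr_gt0 ?divr_gt0.
move=> V e beta rho [sym irr _] rho1 b0 lo hi.
have V0 : (0 < #|V|)%N.
  (* On the empty graph the spectral radius is the supremum of the empty set,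
     which is 0. *)
  rewrite lt0n; apply/eqP => V0; move: rho1.
  rewrite /rho /spectral_radius (_ : [set r | _]%classic = set0).
    by rewrite sup0 ltr10.
  apply/seteqP; split=> // r [z /eigenvalueP[v _ /eqP[]]].
  by apply/rowP => i; have := ltn_ord i; rewrite {2}V0.
set n : R := #|V|%:R.
have n1 : 1 <= n by rewrite ler1n.
have n0 : 0 < n by rewrite ltr0n.
have rho0 : 0 < rho by apply: lt_trans rho1.
pose kappa := (1 - delta) / rho.
have k0 : 0 < kappa by rewrite divr_gt0 ?subr_gt0.
have hk : `|beta - 1| <= kappa * (beta + 1).
  rewrite /kappa mulrAC ler_pdivlMr //.
  move: lo hi; rewrite ler_pdivrMr ?ler_pdivlMr; [|lra|lra] => lo hi.
  by rewrite -{1}(gtr0_norm rho0) -normrM ler_norml; apply/andP; split; lra.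
(* Chosen so that t (delta / n) >= 4 n. *)
pose t := (Num.trunc (4 * n ^+ 2 / delta)).+1.
have t_lo : 4 * n ^+ 2 / delta <= t%:R.
  by rewrite ltW // truncnS_gt.
have t_hi : t%:R <= 4 * n ^+ 2 / delta + 1.
  by rewrite /t -(natr1 (Num.trunc _)) lerD2r truncn_le // divr_ge0 ?mulr_ge0 ?sqr_ge0 // ltW.
apply: (@le_trans _ _ (t%:R)%:E).
  apply: ereal_inf_lbound; exists t => // s /=.
  apply: le_trans (glauber_tv_le e beta kappa t s sym irr b0 V0 k0 hk) _.
  rewrite -/rho /kappa mulfVK ?gt_eqF // opprB addrCA subrr addr0 -/n.
  have x01 : 0 <= delta / n <= 1.
    rewrite divr_ge0 ?(ltW d0) ?(ltW n0) //= ler_pdivrMr // mul1r.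
    by rewrite (le_trans (ltW d1)).
  have := exp_subr1_bernoulli _ t x01.
  have : 4 * n <= t%:R * (delta / n).
    by rewrite mulrA ler_pdivlMr // -ler_pdivrMr // -[4 * n * n]mulrA -expr2.
  have : 0 <= (1 - delta / n) ^+ t by rewrite exprn_ge0 // subr_ge0; case/andP: x01.
  by nra.
rewrite lee_fin; apply: le_trans t_hi _.
apply: (@le_trans _ _ ((4 / delta + 1) * n ^+ 2)).
  have -> : (4 / delta + 1) * n ^+ 2 = 4 * n ^+ 2 / delta + n ^+ 2 by ring.
  by rewrite lerD2l exprn_ege1.
rewrite ler_wpM2l ?addr_ge0 ?divr_ge0 ?(ltW d0) //.
rewrite -powR_mulrn ?(ltW n0) // ler_powR //.
have : 1 <= 1 / delta by rewrite ler_pdivlMr // mul1r ltW.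
lra.
Qed.
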